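(* Let $G$ be a tidy $(H,\mathcal P)$-graph such that $\textnormal{tww}(G)\ge 3$ and all paths in $\mathcal P$ have length at least $3\cdot f_H(2|V(H)|^2)+9$, and let $G'$ be any trigraph obtained from $G$ by shortening paths in $\mathcal P$ (by contracting consecutive vertices) to arbitrary lengths no shorter than $3\cdot f_H(2|V(H)|^2)+9$. Then $\textnormal{tww}(G')\le \textnormal{tww}(G)+1$.
   Context: $f_H:\mathbb N\to\mathbb N$ is defined by $f_H(\ell)=(3^{|V(H)|+4}\cdot|V(H)|^2)^{\ell}$. A trigraph has edges partitioned into black and red edges. Contracting two distinct vertices $u,v$ replaces them by a new vertex $w$ joined by a black edge to each vertex joined to both by black edges and by a red edge to every other vertex adjacent to $u$ or $v$. A contraction sequence of $G$ contracts repeatedly until one vertex remains; its width is the maximum red degree appearing; $\textnormal{tww}(G)$ is the minimum width. The length of a path is its number of edges. Stumps: a vertex $u$ has a half stump $v$ if $uv$ is black and $\deg v=1$; a red (resp. black) stump $vw$ if $uv$ is black, $vw$ is red (resp. black), $\deg v=2$, $\deg w=1$. A dangling pseudo-path is an induced subtrigraph obtained from a path $P$ whose vertices have degree $2$ apart from their stumps by adding to each vertex of $P$ either one red stump or at most one black stump and at most one half stump. An $(H,\mathcal P)$-graph is a connected trigraph $G$ with $\textnormal{tww}(G)\ge 2$ whose vertices are partitioned into an induced subtrigraph $H$ and the disjoint union $\sqcup\mathcal P$ of a set $\mathcal P$ of dangling pseudo-paths. A connector is a vertex of $H$ adjacent to a vertex of $\sqcup\mathcal P$. A path $P\in\mathcal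 P$ is tidy if all its edges are red and its vertices have degree $2$ in $G$ (no stumps), and for each connector $u$ adjacent to an endpoint $v$ of $P$: (1) $u$ has black degree $0$; (2) $v$ is the only neighbour of $u$ in $\sqcup\mathcal P$; (3) $u$ has a unique neighbour $u'$ in $V(H)$ and $u'$ has positive black degree. The $(H,\mathcal P)$-graph is tidy if all paths in $\mathcal P$ are tidy. *)

(* Defs.v *)
From HB Require Import structures.
From mathcomp Require Import all_boot.
From mathcomp Require Import boolp.

Set Implicit Arguments.
Unset Strict Implicit.
Unset Printing Implicit Defensive.

Record trigraph := Trigraph {
  vertex :> finType;
  black : rel vertex;
  red : rel vertex;
  black_sym : symmetric black;
  black_irr : irreflexive black;
  red_sym : symmetric red;
  red_irr : irreflexive red;
  black_red : forall x y, ~~ (black x y && red x y) }.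

Section Basics.
Variable G : trigraph.
Implicit Types u v w : G.

Definition adj u v : bool := black u v || red u v.

Definition deg u : nat := #|[set v | adj u v]|.
Definition black_deg u : nat := #|[set v | black u v]|.
Definition red_deg u : nat := #|[set v | red u v]|.

Definition max_red_deg : nat := \max_(u : G) red_deg u.

Definition connected : Prop :=
  0 < #|G| /\ forall u v, connect adj u v.

End Basics.

Section Contraction.
Variables (G : trigraph) (u v : G).

(* [None] is the new vertex. *)
Definition contract_vertex : finType :=
  option {x : G | (x != u) && (x != v)}.

Definition contract_black (a b : contract_vertex) : bool :=
  match a, b with
  | Some x, Some y => black (val x) (val y)
  | None, Some y | Some y, None => black u (val y) && black v (val y)
  | None, None => false
  end.

Definition contract_red (a b : contract_vertex) : bool :=
  match a, b with
  | Some x, Some y => red (val x) (val y)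
  | None, Some y | Some y, None =>
      (adj u (val y) || adj v (val y))
      && ~~ (black u (val y) && black v (val y))
  | None, None => false
  end.

Lemma contract_black_sym : symmetric contract_black.
Proof. by case=> [x|] [y|] //=; rewrite black_sym. Qed.

Lemma contract_black_irr : irreflexive contract_black.
Proof. by case=> [x|] //=; rewrite black_irr. Qed.

Lemma contract_red_sym : symmetric contract_red.
Proof. by case=> [x|] [y|] //=; rewrite red_sym. Qed.

Lemma contract_red_irr : irreflexive contract_red.
Proof. by case=> [x|] //=; rewrite red_irr. Qed.

Lemma contract_black_red a b : ~~ (contract_black a b && contract_red a b).
Proof.
case: a b => [x|] [y|] //=; first exact: black_red.
all: by case: (black u _ && black v _); rewrite ?andbF.
Qed.

Definition contract : trigraph :=
  Trigraph contract_black_sym contract_black_irr contract_red_sym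
    contract_red_irr contract_black_red.

(* Sends [u] and [v] to the new vertex and any other vertex to itself. *)
Definition contract_proj (x : G) : contract := insub x.

Lemma card_contract : u != v -> #|contract| = #|G|.-1.
Proof.
move=> uv; rewrite card_option card_sig.
have -> : #|[pred x | (x != u) && (x != v)]| = #|~: [set u; v]|.
  by apply: eq_card => x; rewrite !inE negb_or.
rewrite -(cardsC [set u; v]) cards2 uv.
by [].
Qed.

End Contraction.

Inductive contraction_seq : trigraph -> Type :=
| ContractionEnd (G : trigraph) : #|G| = 1 -> contraction_seq G
| ContractionStep (G : trigraph) (u v : G) :
    u != v -> contraction_seq (contract u v) -> contraction_seq G.

Fixpoint width G (s : contraction_seq G) : nat :=
  match s with
  | ContractionEnd G _ => max_red_deg G
  | ContractionStep G _ _ _ s' => maxn (max_red_deg G) (width s')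
  end.

(* The value is 0 for the empty trigraph, which has no contraction sequence;
   [tww_spec] characterises the value for every other trigraph. *)
Definition tww (G : trigraph) : nat :=
  match pselect (exists k, `[< exists s : contraction_seq G, width s = k >])
  with
  | left ex_width => ex_minn ex_width
  | right _ => 0
  end.

Lemma contraction_seq_exists (G : trigraph) :
  0 < #|G| -> inhabited (contraction_seq G).
Proof.
have [n] := ubnP #|G|; elim: n G => // n IHn G leGn G_gt0.
have [G1|Gn1] := eqVneq #|G| 1; first exact: inhabits (ContractionEnd G1).
have G_gt1 : 1 < #|G| by rewrite ltn_neqAle eq_sym Gn1.
have /card_gt1P [u [v [_ _ uv]]] := G_gt1.
have [||s] := IHn (contract u v).
- by rewrite card_contract // prednK // -ltnS.
- by rewrite card_contract // -ltnS prednK.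
- exact: inhabits (ContractionStep uv s).
Qed.

Lemma tww_spec (G : trigraph) : 0 < #|G| ->
  (exists s : contraction_seq G, width s = tww G) /\
  forall s : contraction_seq G, tww G <= width s.
Proof.
move=> /contraction_seq_exists[s0]; rewrite /tww; case: pselect => [ex|[]].
  case: ex_minnP => k /asboolP exk mink; split=> // s.
  by apply: mink; apply/asboolP; exists s.
by exists (width s0); apply/asboolP; exists s0.
Qed.

Section PseudoPaths.
Variable G : trigraph.
Implicit Types (u v w x y : G) (s p : seq G) (X Y H : {set G}).
Implicit Types P : {set {set G}}.

Definition induced_path s : Prop :=
  uniq s /\
  {in s &, forall x y, adj x y = (index y s == (index x s).+1)
                              || (index x s == (index y s).+1)}.

Definition half_stump u v : bool := black u v && (deg v == 1).

Definition red_stump u v w : bool :=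
  [&& black u v, red v w, deg v == 2 & deg w == 1].

Definition black_stump u v w : bool :=
  [&& w != u, black u v, black v w, deg v == 2 & deg w == 1].

(* The stumps of [u] all of whose vertices lie in [S]. *)
Definition half_stumps (S : {set G}) u : {set G} := [set v in S | half_stump u v].
Definition red_stumps (S : {set G}) u : {set G * G} :=
  [set e | [&& e.1 \in S, e.2 \in S & red_stump u e.1 e.2]].
Definition black_stumps (S : {set G}) u : {set G * G} :=
  [set e | [&& e.1 \in S, e.2 \in S & black_stump u e.1 e.2]].

(* Pseudo-paths, being induced subtrigraphs, are given by their vertex sets;
   [s] is the underlying path and [S] the set of vertices of the stumps. *)
Definition dangling_pseudo_path X : Prop :=
  exists s (S : {set G}),
  [/\ s != [::] /\ induced_path s,
      X = [set x in s] :|: S /\ [disjoint [set x in s] & S],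
      {in s, forall u, #|[set v | adj u v] :\: S| = 2},
      {in s, forall u,
         [/\ #|red_stumps S u| = 1, #|black_stumps S u| = 0
           & #|half_stumps S u| = 0]
         \/
         [/\ #|red_stumps S u| = 0, #|black_stumps S u| <= 1
           & #|half_stumps S u| <= 1]}
    & {in S, forall y, exists2 u, u \in s &
         [\/ y \in half_stumps S u,
             exists2 e, e \in red_stumps S u & (y == e.1) || (y == e.2)
           | exists2 e, e \in black_stumps S u & (y == e.1) || (y == e.2)]}].

(* The last condition expresses that the subtrigraph induced by [cover P] is
   the disjoint union of the members of [P]. *)
Definition HP_graph H P : Prop :=
  [/\ connected G,
      2 <= tww G,
      H :|: cover P = setT /\ [disjoint H & cover P],
      {in P, forall X, dangling_pseudo_path X}
    & trivIset P /\
      {in P &, forall X Y, X != Y ->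
         {in X & Y, forall x y, ~~ adj x y}}].

Definition connector H P u : Prop :=
  u \in H /\ exists2 v, v \in cover P & adj u v.

Definition tidy_path H P X : Prop :=
  exists x p,
  [/\ induced_path (x :: p),
      X = [set y in x :: p],
      {in X &, forall y z, adj y z -> red y z},
      {in X, forall y, deg y = 2}
    & forall u v, connector H P u -> v \in [:: x; last x p] -> adj u v ->
      [/\ black_deg u = 0,
          [set y in cover P | adj u y] = [set v]
        & exists2 u', [set y in H | adj u y] = [set u'] & 0 < black_deg u']].

Definition tidy_HP_graph H P : Prop :=
  HP_graph H P /\ {in P, forall X, tidy_path H P X}.

(* For a path without stumps, given by its vertex set. *)
Definition path_length X : nat := #|X|.-1.

Definition fH H (l : nat) : nat := (3 ^ (#|H| + 4) * #|H| ^ 2) ^ l.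

Definition min_length H : nat := 3 * fH H (2 * #|H| ^ 2) + 9.

End PseudoPaths.

(* [shortening P' P]: the trigraph of [P'] arises from that of [P] by
   successively contracting two consecutive vertices of a path, and [P'] is the
   resulting family of paths. A path is given by its vertex set and is induced,
   so its consecutive vertices are its adjacent ones. *)
Inductive shortening (G' : trigraph) (P' : {set {set G'}}) :
    forall G : trigraph, {set {set G}} -> Prop :=
| ShorteningRefl : shortening P' P'
| ShorteningStep (G : trigraph) (P : {set {set G}}) (X : {set G}) (u v : G) :
    X \in P -> u \in X -> v \in X -> adj u v ->
    shortening P' [set contract_proj u v @: (Y : {set G}) | Y in P] ->
    shortening P' P.

(* Main.v *)
(* Let t = tww G.  The core C is H without its connectors; being induced in G it
   has a contraction sequence of width at most t, and G' consists of C and of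
   red "ears", each a path of G' together with its two connectors.
   Make C redder by adding a red path, the bus, with one vertex attached to each
   vertex of C, in an order in which every part of every partition of the
   sequence of C is an interval.  Then C with its bus has twin-width at most
   t + 1: before two parts are merged, their consecutive bus vertices are
   merged, at the price of a bus vertex of red degree 4 <= t + 1, and every part
   has only one more red neighbour than in C.
   An ear with at least |C| vertices can be zipped into the bus, vertex by
   vertex, walking along the bus from the position of one end to that of the
   other; this again creates red degree at most 4 on the bus.  As the twin-width
   does not decrease when a trigraph is enlarged or made redder,
   tww G' <= t + 1. *)
Require Import Defs.
From mathcomp Require Import all_boot.
From mathcomp Require Import zify.
From mathcomp Require boolp.

Set Implicit Arguments.
Unset Strict Implicit.
Unset Printing Implicit Defensive.

(** * Finite sets and enumerations *)

Lemma card_sum_set (A B : finType) (P : pred (A + B)) :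
  #|[set v | P v]| = #|[set a | P (inl a)]| + #|[set b | P (inr b)]|.
Proof. by rewrite -!sum1dep_card big_sumType. Qed.

Lemma card_set_le1 (T : finType) (P : pred T) :
  (forall x y, P x -> P y -> x = y) -> #|[set x | P x]| <= 1.
Proof.
by move=> Puniq; apply/card_le1_eqP => x y; rewrite !inE => Px Py; exact: Puniq.
Qed.

Lemma card_set_leD (T : finType) (P Q R : pred T) :
  (forall x, P x -> Q x || R x) ->
  #|[set x | P x]| <= #|[set x | Q x]| + #|[set x | R x]|.
Proof.
move=> PQR; apply: leq_trans (leq_card_setU _ _).
by apply/subset_leq_card/subsetP => x; rewrite !inE => /PQR.
Qed.

Lemma card_ord_adjacent n (p : 'I_n) (P : pred 'I_n) :
  (forall q : 'I_n, P q -> (p.+1 == q) || (q.+1 == p)) -> #|[set q | P q]| <= 2.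
Proof.
move=> Pp; apply: leq_trans (card_set_leD Pp) _.
by apply: (@leq_add _ _ 1 1); apply: card_set_le1 => x y /eqP xp /eqP yp;
  apply: val_inj => /=; lia.
Qed.

Lemma card_fiber_inj (T : finType) (S : eqType) (f : T -> S) y :
  injective f -> #|[set x | f x == y]| <= 1.
Proof. by move=> fI; apply: card_set_le1 => x x' /eqP <- /eqP/esym/fI. Qed.

Lemma card_enum_val_set (T : finType) (P : pred T) :
  #|[set j : 'I_#|T| | P (enum_val j)]| = #|[set x | P x]|.
Proof.
rewrite -(on_card_preimset (onW_bij _ (@enum_val_bij T))).
by apply: eq_card => j; rewrite !inE.
Qed.

Lemma index_allpairs_pair (S T : eqType) (s : seq S) (t : seq T) x y :
  x \in s -> y \in t ->
  index (x, y) [seq (x, y) | x <- s, y <- t] = index x s * size t + index y t.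
Proof.
move=> + yt; elim: s => // x' s IHs; rewrite inE allpairs_cons index_cat.
have [->|x'x /= xs] := eqVneq x x'.
  by rewrite mem_map ?yt ?index_map /= ?eqxx // => ? ? [].
rewrite ifN; last by apply/mapP => -[y' _ [xE _]]; rewrite xE eqxx in x'x.
by rewrite size_map IHs // eq_sym (negPf x'x) mulSn addnA.
Qed.

Lemma enum_rank_index (T : finType) (x : T) :
  enum_rank x = index x (enum T) :> nat.
Proof.
by rewrite -{2}[x](nth_enum_rank x) index_uniq ?enum_uniq // -cardE ltn_ord.
Qed.

Lemma enum_rank_succ (I : finType) D (i : I) (j j' : 'I_D) :
  j.+1 = j' -> (enum_rank (i, j)).+1 = enum_rank (i, j') :> nat.
Proof.
move=> jj'; rewrite !enum_rank_index enumT unlock /= /prod_enum.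
by rewrite !index_allpairs_pair ?mem_enum // !index_enum_ord -jj' addnS.
Qed.

Lemma unbump_eq k j j' :
  unbump k j = unbump k j' ->
  j = j' \/ j \in [:: k; k.+1] /\ j' \in [:: k; k.+1].
Proof. by rewrite /unbump !inE; lia. Qed.

Lemma unbump_succ k j :
  unbump k j.+1 = unbump k j \/ unbump k j.+1 = (unbump k j).+1.
Proof. by rewrite /unbump; lia. Qed.

(** * Maps merging a single pair *)

Definition merges_only (S T : eqType) (g : S -> T) (u v : S) : Prop :=
  forall x y, g x = g y -> x = y \/ x \in [:: u; v] /\ y \in [:: u; v].

Lemma merges_only_pair (S T : eqType) (g : S -> T) u v x y :
  merges_only g u v -> x != y -> g x = g y -> merges_only g x y.
Proof.
move=> guv xy /guv[/eqP|[xuv yuv]]; first by rewrite (negPf xy).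
have sub z : z \in [:: u; v] -> z \in [:: x; y].
  move=> zuv; move: xuv yuv zuv xy; rewrite !inE.
  by do 3!case/orP=> /eqP ->; rewrite eqxx ?orbT.
by move=> a b /guv[|[/sub auv /sub buv]]; [left|right].
Qed.

Lemma merges_only_comp_inj (S T U : eqType) (f : S -> T) (g : T -> U) u v :
  injective f -> merges_only g (f u) (f v) -> merges_only (g \o f) u v.
Proof.
move=> fI guv x y /guv[/fI|]; first by left.
by rewrite -[[:: _; _]]/(map f [:: u; v]) !mem_map //; right.
Qed.

Definition map_sum (A B A' B' : Type) (f : A -> A') (g : B -> B') (v : A + B) :
    A' + B' :=
  match v with inl a => inl (f a) | inr b => inr (g b) end.

Section MapSumMerges.
Variables (A B A' B' : eqType) (f : A -> A') (g : B -> B').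

Lemma map_sum_merges_onlyl u v :
  merges_only f u v -> injective g ->
  merges_only (map_sum f g) (inl u) (inl v).
Proof.
move=> fuv gI [x|p] [y|q] //= [].
  by case/fuv => [->|[]]; rewrite !inE; [left|right].
by move/gI=> ->; left.
Qed.

Lemma map_sum_merges_onlyr u v :
  injective f -> merges_only g u v ->
  merges_only (map_sum f g) (inr u) (inr v).
Proof.
move=> fI guv [x|p] [y|q] //= []; first by move/fI=> ->; left.
by case/guv => [->|[]]; rewrite !inE; [left|right].
Qed.

End MapSumMerges.

(** * Twin-width and coarsenings *)

Section Adjacency.
Variable G : trigraph.
Implicit Types x y : G.

Lemma adj_sym : symmetric (@adj G).
Proof. by move=> x y; rewrite /adj black_sym red_sym. Qed.

Lemma adj_irr : irreflexive (@adj G).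
Proof. by move=> x; rewrite /adj black_irr red_irr. Qed.

Lemma adj_neq x y : adj x y -> x != y.
Proof. by apply: contraTneq => ->; rewrite adj_irr. Qed.

Lemma black_deg0 x y : black_deg x = 0 -> black x y = false.
Proof. by move/eqP; rewrite cards_eq0 => /eqP/setP/(_ y); rewrite !inE. Qed.

Lemma adj_black_deg0 x y : black_deg x = 0 -> adj x y = red x y.
Proof. by move=> x0; rewrite /adj black_deg0. Qed.

Definition eqadj x y : bool := (x == y) || adj x y.

Lemma eqadj_sym : symmetric eqadj.
Proof. by move=> x y; rewrite /eqadj eq_sym adj_sym. Qed.

Lemma eqadj_refl : reflexive eqadj.
Proof. by move=> x; rewrite /eqadj eqxx. Qed.

Lemma adjW x y : adj x y -> eqadj x y.
Proof. by rewrite /eqadj => ->; rewrite orbT. Qed.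

Lemma red_deg_max x : red_deg x <= max_red_deg G.
Proof. exact: leq_bigmax. Qed.

Lemma max_red_deg_leP k :
  reflect (forall x, red_deg x <= k) (max_red_deg G <= k).
Proof. by apply: (iffP (@bigmax_leqP _ _ _ _)) => Gk x *; exact: Gk. Qed.

End Adjacency.

Lemma tww_empty (G : trigraph) : #|G| = 0 -> tww G = 0.
Proof.
move=> G_empty; rewrite /tww; case: boolp.pselect => // ex_s; exfalso.
have [k /boolp.asboolP[s _]] := ex_s.
by case: s G_empty => [K ->|K u v _ _ /card0_eq/(_ u)].
Qed.

Lemma max_red_deg_tww (G : trigraph) : max_red_deg G <= tww G.
Proof.
apply/max_red_deg_leP => x; have G_gt0 : 0 < #|G| by apply/card_gt0P; exists x.
have [[s <-] _] := tww_spec G_gt0; case: s x {G_gt0} => [K K1|K u v uv s] x.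
  exact: red_deg_max.
by rewrite /= leq_max red_deg_max.
Qed.

Lemma tww_contract (G : trigraph) (u v : G) :
  u != v -> tww G <= maxn (max_red_deg G) (tww (contract u v)).
Proof.
move=> uv; have G_gt0 : 0 < #|G| by apply/card_gt0P; exists u.
have Guv_gt0 : 0 < #|contract u v| by apply/card_gt0P; exists None.
have [[s <-] _] := tww_spec Guv_gt0.
exact: (tww_spec G_gt0).2 (ContractionStep uv s).
Qed.

(* Up to the identifications made by [g], the trigraph [K] arises from [G] by
   adding vertices and red edges and by turning black edges red. *)
Record coarsening (G K : trigraph) (g : G -> K) : Prop := Coarsening {
  coarsening_adj : {homo g : x y / adj x y >-> eqadj x y};
  coarsening_black : forall x y, black (g x) (g y) -> black x y }.

Lemma coarsening_eqadj (G K : trigraph) (g : G -> K) :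
  coarsening g -> {homo g : x y / eqadj x y}.
Proof.
by move=> gc x y /orP[/eqP ->|/(coarsening_adj gc)]; rewrite ?eqadj_refl.
Qed.

Lemma coarsening_id (G : trigraph) : coarsening (@id G).
Proof. by split=> // x y; exact: adjW. Qed.

Lemma coarsening_comp (G K L : trigraph) (g : G -> K) (f : K -> L) :
  coarsening g -> coarsening f -> coarsening (f \o g).
Proof.
move=> gc fc; split=> x y.
  by move/(coarsening_adj gc)/(coarsening_eqadj fc).
by move/(coarsening_black fc)/(coarsening_black gc).
Qed.

Lemma coarsening_max_red_deg (G K : trigraph) (g : G -> K) :
  coarsening g -> injective g -> max_red_deg G <= max_red_deg K.
Proof.
move=> gc gI; apply/max_red_deg_leP => x; apply: leq_trans (red_deg_max (g x)).
rewrite /red_deg -(card_imset _ gI); apply/subset_leq_card/subsetP => z.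
case/imsetP=> y; rewrite !inE => xy ->{z}.
have /(coarsening_adj gc) : adj x y by rewrite /adj xy orbT.
case/or3P=> [/eqP/gI xyE|/(coarsening_black gc) xy_black|//].
  by rewrite xyE red_irr in xy.
by have := black_red x y; rewrite xy_black xy.
Qed.

Section ContractionMaps.
Variables (G : trigraph) (u v : G).

Variant contract_proj_spec (x : G) : contract u v -> Type :=
| ContractPair of x \in [:: u; v] : contract_proj_spec x None
| ContractOther (z : {x : G | (x != u) && (x != v)}) of val z = x :
    contract_proj_spec x (Some z).

Lemma contract_projP x : contract_proj_spec x (contract_proj u v x).
Proof.
rewrite /contract_proj; case: insubP => [z _ zx|]; first exact: ContractOther.
by rewrite negb_and !negbK => xuv; constructor; rewrite !inE.
Qed.

Lemma contract_proj_pair x : x \in [:: u; v] -> contract_proj u v x = None.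
Proof. by rewrite !inE => xuv; apply: insubN; rewrite negb_and !negbK. Qed.

Lemma contract_proj_merges_only : merges_only (contract_proj u v) u v.
Proof.
move=> x y; case: contract_projP => [xuv|z <-];
  case: contract_projP => [yuv|z' <-] //; first by right.
by case=> ->; left.
Qed.

Definition contract_repr (a : contract u v) : G :=
  if a is Some z then val z else u.

Lemma contract_reprK : cancel contract_repr (contract_proj u v).
Proof.
case=> [z|] /=; first exact: valK.
by rewrite contract_proj_pair // mem_head.
Qed.

Lemma contract_projK : {in predC1 v, cancel (contract_proj u v) contract_repr}.
Proof.
move=> x xv; case: contract_projP => //=.
by rewrite !inE (negPf xv) orbF => /eqP.
Qed.

Lemma adj_contract_None z :
  @adj (contract u v) None (Some z) = adj u (val z) || adj v (val z).
Proof.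
rewrite {1}/adj /= orb_andr orbN andbT /adj.
by case: (black u _); case: (black v _); rewrite ?orbT.
Qed.

Lemma coarsening_contract_proj : coarsening (contract_proj u v).
Proof.
split=> x y; case: contract_projP => [xuv|z <-];
  case: contract_projP => [yuv|z' <-].
- by [].
- move=> xz'; apply: adjW; rewrite adj_contract_None.
  by move: xuv xz'; rewrite !inE => /orP[] /eqP -> ->; rewrite ?orbT.
- move=> zy; apply: adjW; rewrite adj_sym adj_contract_None.
  rewrite !(adj_sym _ (val z)).
  by move: yuv zy; rewrite !inE => /orP[] /eqP -> ->; rewrite ?orbT.
- exact: adjW.
- by rewrite black_irr.
- by move: xuv; rewrite !inE /= => /orP[] /eqP -> /andP[].
- by move: yuv; rewrite (black_sym _ y) !inE /= => /orP[] /eqP -> /andP[].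
- by [].
Qed.

Variables (K : trigraph) (g : G -> K).

Lemma coarsening_contract_repr :
  coarsening g -> g u = g v -> coarsening (g \o contract_repr).
Proof.
move=> gc guv; have adj_None z : @adj (contract u v) None (Some z) ->
    eqadj (g u) (g (val z)).
  by rewrite adj_contract_None => /orP[]/(coarsening_adj gc) //; rewrite guv.
split=> [] [x|] [y|] //=.
- exact: (coarsening_adj gc).
- by rewrite adj_sym eqadj_sym => /adj_None.
- exact: adj_None.
- exact: (coarsening_black gc).
- move=> xu; rewrite black_sym in xu.
  by rewrite (coarsening_black gc xu) (coarsening_black gc) // -guv.
- by move=> uy; rewrite (coarsening_black gc uy) (coarsening_black gc) // -guv.
- by rewrite black_irr.
Qed.

Lemma inj_contract_repr :
  merges_only g u v -> injective (g \o contract_repr).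
Proof.
move=> guv a b /guv ab; rewrite -[a]contract_reprK -[b]contract_reprK.
by case: ab => [->//|[/contract_proj_pair -> /contract_proj_pair ->]].
Qed.

End ContractionMaps.

(* The contractions of [s] are replayed in [G], skipping those of a pair that is
   not contained in the image of [g]. *)
Lemma tww_coarsening_width (K : trigraph) (s : contraction_seq K)
    (G : trigraph) (g : G -> K) :
  coarsening g -> injective g -> 0 < #|G| -> tww G <= width s.
Proof.
elim: s G g => {K} [K K1|K u v uv s IHs] G g gc gI G_gt0.
  have G1 : #|G| = 1.
    by apply/eqP; rewrite eqn_leq G_gt0 andbT -K1; exact: leq_card gI.
  apply: leq_trans (coarsening_max_red_deg gc gI).
  exact: (tww_spec G_gt0).2 (ContractionEnd G1).
pose f := contract_proj u v \o g.
have fc : coarsening f := coarsening_comp gc (coarsening_contract_proj u v).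
have [/injectiveP fI|/injectivePn[x [y xy fxy]]] := boolP (injectiveb f).
  by rewrite /= leq_max (IHs _ _ fc fI G_gt0) orbT.
apply: leq_trans (tww_contract xy) _; rewrite geq_max /= !leq_max.
rewrite (coarsening_max_red_deg gc gI) /=; apply/orP; right.
apply: (IHs _ (f \o @contract_repr _ x y)).
- exact: coarsening_contract_repr.
- apply/inj_contract_repr/merges_only_comp_inj => //.
  apply: (merges_only_pair (@contract_proj_merges_only K u v)) => //.
  by rewrite (inj_eq gI).
- by apply/card_gt0P; exists None.
Qed.

Lemma tww_coarsening_inj (G K : trigraph) (g : G -> K) :
  coarsening g -> injective g -> tww G <= tww K.
Proof.
move=> gc gI; have [/tww_empty -> //|G_gt0] := posnP #|G|.
have [[s <-] _] := tww_spec (leq_trans G_gt0 (leq_card _ gI)).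
exact: tww_coarsening_width gI G_gt0.
Qed.

Lemma tww_merge (G K : trigraph) (g : G -> K) (u v : G) :
  coarsening g -> merges_only g u v ->
  tww G <= maxn (max_red_deg G) (tww K).
Proof.
move=> gc guv.
have [/injectiveP gI|/injectivePn[x [y xy gxy]]] := boolP (injectiveb g).
  by rewrite leq_max (tww_coarsening_inj gc gI) orbT.
apply: leq_trans (tww_contract xy) _; rewrite geq_max leq_maxl leq_max.
rewrite (@tww_coarsening_inj _ _ (g \o @contract_repr _ x y)) ?orbT //.
  exact: coarsening_contract_repr.
exact/inj_contract_repr/(merges_only_pair guv).
Qed.

Definition induced (G : trigraph) (D : {set G}) : trigraph :=
  @Trigraph {x : G | x \in D} (fun x y => black (val x) (val y))
    (fun x y => red (val x) (val y))
    (fun x y => black_sym (val x) (val y)) (fun x => black_irr (val x))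
    (fun x y => red_sym (val x) (val y)) (fun x => red_irr (val x))
    (fun x y => black_red (val x) (val y)).

Lemma mem_induced (G : trigraph) (D : {set G}) (x : induced D) : val x \in D.
Proof. exact: valP x. Qed.

Lemma tww_induced (G : trigraph) (D : {set G}) : tww (induced D) <= tww G.
Proof.
apply: (@tww_coarsening_inj (induced D) G val); last exact: val_inj.
by split=> // x y; exact: adjW.
Qed.

(** * Red extensions *)

Section RedExtension.
Variables (C : trigraph) (B : finType) (e : rel B) (att : C -> B -> bool).

Definition red_ext_black (v w : C + B) : bool :=
  if v is inl x then if w is inl y then black x y else false else false.

Definition red_ext_red (v w : C + B) : bool :=
  match v, w with
  | inl x, inl y => red x y
  | inl x, inr p | inr p, inl x => att x p
  | inr p, inr q => (p != q) && (e p q || e q p)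
  end.

Lemma red_ext_black_sym : symmetric red_ext_black.
Proof. by case=> [x|p] [y|q] //=; rewrite black_sym. Qed.

Lemma red_ext_black_irr : irreflexive red_ext_black.
Proof. by case=> [x|p] //=; rewrite black_irr. Qed.

Lemma red_ext_red_sym : symmetric red_ext_red.
Proof. by case=> [x|p] [y|q] //=; rewrite 1?red_sym // eq_sym orbC. Qed.

Lemma red_ext_red_irr : irreflexive red_ext_red.
Proof. by case=> [x|p] //=; rewrite ?red_irr // eqxx. Qed.

Lemma red_ext_black_red v w : ~~ (red_ext_black v w && red_ext_red v w).
Proof. by case: v w => [x|p] [y|q] //=; exact: black_red. Qed.

Definition red_ext : trigraph :=
  Trigraph red_ext_black_sym red_ext_black_irr red_ext_red_sym red_ext_red_irr
    red_ext_black_red.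

Lemma eqadj_red_ext (v w : red_ext) :
  eqadj v w =
  match v, w with
  | inl x, inl y => eqadj x y
  | inl x, inr p | inr p, inl x => att x p
  | inr p, inr q => [|| p == q, e p q | e q p]
  end.
Proof.
case: v w => [x|p] [y|q] //; rewrite /eqadj /adj //=.
by rewrite -[inr p == inr q]/(p == q); case: eqP.
Qed.

Lemma red_deg_red_extl (x : C) :
  @red_deg red_ext (inl x) = red_deg x + #|[set p | att x p]|.
Proof. by rewrite /red_deg card_sum_set. Qed.

Lemma red_deg_red_extr (p : B) :
  @red_deg red_ext (inr p) =
  #|[set x | att x p]| + #|[set q | (p != q) && (e p q || e q p)]|.
Proof. by rewrite /red_deg card_sum_set. Qed.

Lemma coarsening_inl : @coarsening C red_ext inl.
Proof. by split=> // x y /adjW; rewrite eqadj_red_ext. Qed.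

Lemma coarsening_red_ext (K : trigraph) (g : C + B -> K) :
  @coarsening C K (g \o inl) ->
  (forall x p, att x p -> eqadj (g (inl x)) (g (inr p))) ->
  (forall p q, e p q -> eqadj (g (inr p)) (g (inr q))) ->
  (forall p v, black (g (inr p)) (g v) = false) ->
  @coarsening red_ext K g.
Proof.
move=> gc g_att g_e g_black; split=> [] [x|p] [y|q]; rewrite ?g_black //.
- exact: (coarsening_adj gc).
- by case/orP=> // /g_att.
- by case/orP=> // /g_att; rewrite eqadj_sym.
- by case/orP=> // /andP[_ /orP[] /g_e //]; rewrite eqadj_sym.
- exact: (coarsening_black gc).
- by rewrite black_sym g_black.
Qed.

End RedExtension.

Lemma coarsening_map_red_ext (C C' : trigraph) (B B' : finType)
    (e : rel B) (e' : rel B') (att : C -> B -> bool) (att' : C' -> B' -> bool)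
    (f : C -> C') (g : B -> B') :
  coarsening f ->
  (forall p q, e p q -> (g p == g q) || e' (g p) (g q)) ->
  (forall x p, att x p -> att' (f x) (g p)) ->
  @coarsening (red_ext e att) (red_ext e' att') (map_sum f g).
Proof.
move=> fc ge fg; apply: coarsening_red_ext => [|x p xp|p q pq|p v] //.
- exact: (coarsening_comp fc (coarsening_inl e' att')).
- by rewrite eqadj_red_ext; exact: fg.
- by rewrite eqadj_red_ext /= orbA ge.
Qed.

(** * The bus *)

Definition bus (C : trigraph) (n : nat) (r : C -> nat) : trigraph :=
  red_ext (fun p q : 'I_n.+1 => p.+1 == q) (fun x p => r x == p).

Section Bus.
Variables (C : trigraph) (n : nat) (r : C -> nat).

Lemma red_deg_busl x : @red_deg (bus n r) (inl x) <= (red_deg x).+1.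
Proof.
rewrite red_deg_red_extl -(addn1 (red_deg x)) leq_add2l card_set_le1 //.
by move=> p q /eqP xp /eqP xq; apply: val_inj; rewrite /= -xp.
Qed.

Lemma red_deg_busr p :
  @red_deg (bus n r) (inr p) <= #|[set x | r x == p]| + 2.
Proof.
rewrite red_deg_red_extr leq_add2l (card_ord_adjacent (p := p)) // => q.
by case/andP.
Qed.

Lemma max_red_deg_bus t :
  3 <= t -> max_red_deg C <= t ->
  (forall k, #|[set x | r x == k]| <= 2) -> max_red_deg (bus n r) <= t.+1.
Proof.
move=> t_ge3 /max_red_deg_leP Ct fibers; apply/max_red_deg_leP => [] [x|p].
  by apply: leq_trans (red_deg_busl _) _; exact: Ct.
by apply: leq_trans (red_deg_busr _) _; have := fibers p; lia.
Qed.

Lemma tww_bus_unbump k : k <= n ->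
  tww (bus n.+1 r) <=
  maxn (max_red_deg (bus n.+1 r)) (tww (bus n (unbump k \o r))).
Proof.
move=> kn; pose g (p : 'I_n.+2) : 'I_n.+1 := inord (unbump k p).
have gE p : g p = unbump k p :> nat.
  by rewrite inordK //; have := ltn_ord p; rewrite /unbump; lia.
have k_lt : k.+1 < n.+2 by [].
apply: (@tww_merge (bus _ _) (bus _ _) (map_sum id g)
  (inr (Ordinal (ltnW k_lt))) (inr (Ordinal k_lt))).
  apply: coarsening_map_red_ext => [|p q /eqP pq|x p /eqP].
  - exact: coarsening_id.
  - rewrite -val_eqE /= !gE -pq.
    by case: (unbump_succ k p) => ->; rewrite !eqxx ?orbT.
  - by rewrite gE /= => ->.
apply: map_sum_merges_onlyr => // p q /(congr1 val); rewrite /= !gE.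
case/unbump_eq=> [/val_inj ->|[]]; first by left.
by rewrite !inE -!val_eqE; right.
Qed.

End Bus.

Section BusContract.
Variables (C : trigraph) (u v : C).

Lemma card_fiber_contract_proj (T : eqType) (f : contract u v -> T) y :
  injective f -> #|[set x | f (contract_proj u v x) == y]| <= 2.
Proof.
move=> fI; rewrite (cardsD1 v) (@leq_add _ _ 1 1) ?leq_b1 //.
apply/card_le1_eqP => x x'; rewrite !inE.
move=> /andP[xv /eqP fx] /andP[x'v /eqP fx'].
by apply: (can_in_inj (@contract_projK C u v)) => //; apply: fI; rewrite fx.
Qed.

Lemma tww_bus_contract n (r : contract u v -> nat) :
  tww (bus n (r \o contract_proj u v)) <=
  maxn (max_red_deg (bus n (r \o contract_proj u v))) (tww (bus n r)).
Proof.
apply: (@tww_merge (bus _ _) (bus _ _) (map_sum (contract_proj u v) id)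
  (inl u) (inl v)).
  apply: coarsening_map_red_ext => // [|p q ->]; last by rewrite orbT.
  exact: coarsening_contract_proj.
by apply: map_sum_merges_onlyl => //; exact: contract_proj_merges_only.
Qed.

(* An order on the vertices of the contraction becomes an order on those of [C]
   by replacing the new vertex by [u] followed by [v]. *)
Lemma insert_order n (ruv : contract u v -> nat) :
  u != v -> injective ruv -> (forall a, ruv a <= n) ->
  exists r : C -> nat, [/\ injective r, forall x, r x <= n.+1
    & unbump (ruv None) \o r =1 ruv \o contract_proj u v].
Proof.
move=> uv ruvI ruv_le; set k := ruv None.
have ruv_pair x : x \in [:: u; v] -> ruv (contract_proj u v x) = k.
  by move/contract_proj_pair=> ->.
pose r x := if x == v then k.+1 else bump k.+1 (ruv (contract_proj u v x)).
have rE x : unbump k (r x) = ruv (contract_proj u v x).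
  rewrite /r; have [->|_] := eqVneq x v; last by rewrite /unbump /bump; lia.
  by rewrite ruv_pair ?inE ?eqxx ?orbT // /unbump; lia.
have ru : r u = k by rewrite /r (negPf uv) ruv_pair ?mem_head // /bump; lia.
have rv : r v = k.+1 by rewrite /r eqxx.
exists r; split=> // [x y rxy|x].
  have /ruvI/contract_proj_merges_only :
      ruv (contract_proj u v x) = ruv (contract_proj u v y).
    by rewrite -!rE rxy.
  case=> [//|[xuv yuv]]; move: xuv yuv rxy; rewrite !inE.
  by case/orP=> /eqP -> /orP[] /eqP -> //; rewrite ru rv; lia.
have := ruv_le None; have := ruv_le (contract_proj u v x).
by rewrite /r -/k; case: eqP => _; rewrite /bump; lia.
Qed.

End BusContract.

Lemma tww_bus_card1 t (C : trigraph) (r : C -> nat) :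
  #|C| = 1 -> 3 <= t -> tww C <= t -> tww (bus 0 r) <= t.+1.
Proof.
move=> C1 t_ge3 Ct.
have allC (x y : C) : x = y by apply: (fintype_le1P _); rewrite C1.
have /card_gt0P[x0 _] : 0 < #|C| by rewrite C1.
pose g (v : bus 0 r) : C := if v is inl x then x else x0.
apply: leq_trans (@tww_merge _ _ g (inl x0) (inr ord0) _ _) _.
- by split=> v w; rewrite (allC (g v) (g w)) ?black_irr ?eqadj_refl.
- have all_bus (v : bus 0 r) : v \in [:: inl x0; inr ord0].
    by case: v => [x|p]; rewrite ?(allC x x0) ?(ord1 p) !inE eqxx ?orbT.
  by move=> v w _; right; rewrite !all_bus.
rewrite geq_max (leqW Ct) andbT max_red_deg_bus //.
  exact: leq_trans (max_red_deg_tww C) Ct.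
by move=> k; apply: leq_trans (max_card _) _; rewrite C1.
Qed.

(* The bus lists the vertices of [C] in the order of the leaves of the binary
   tree of contractions, so that every contraction merges two vertices attached
   to consecutive vertices of the bus. *)
Lemma bus_order t (C : trigraph) (s : contraction_seq C) n :
  3 <= t -> width s <= t -> #|C| = n.+1 ->
  exists r : C -> nat,
    [/\ injective r, forall x, r x <= n & tww (bus n r) <= t.+1].
Proof.
move=> t_ge3; elim: s n => {C} [C C1|C u v uv s IHs] n st Cn.
  have allC (x y : C) : x = y by apply: (fintype_le1P _); rewrite C1.
  have n0 : n = 0 by move: Cn; rewrite C1 => -[].
  exists (fun=> 0); rewrite n0; split=> //; apply: tww_bus_card1 => //.
  apply: leq_trans st; apply: (tww_spec _).2 (ContractionEnd C1).
  by rewrite C1.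
move: st; rewrite /= geq_max => /andP[Ct st].
have Cuv := card_contract uv; rewrite Cn /= in Cuv.
case: n Cn Cuv => [|n] Cn Cuv; first by move/card0_eq/(_ None): Cuv.
have [ruv [ruvI ruv_le bus_ruv]] := IHs n st Cuv.
have [r [rI r_le rE]] := insert_order uv ruvI ruv_le.
have bus_pair : tww (bus n (ruv \o contract_proj u v)) <= t.+1.
  apply: leq_trans (tww_bus_contract _ _) _; rewrite geq_max bus_ruv andbT.
  by apply: max_red_deg_bus => // k; exact: card_fiber_contract_proj.
exists r; split=> //; apply: leq_trans (tww_bus_unbump _ (ruv_le None)) _.
rewrite (boolp.funext rE) geq_max bus_pair andbT.
apply: max_red_deg_bus => // k; exact: leq_trans (card_fiber_inj _ rI) _.
Qed.

(** * Zipping a red path *)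

(* A red path with vertices [0], ..., [m.-1], where [j] is to be merged with
   [h j] and is attached to [c j]; the vertex [0] hangs on [p].  The edges whose
   ends are to be merged with vertices that are neither equal nor adjacent are
   left out. *)
Definition rail (K : trigraph) (p : K) m (h : 'I_m -> K)
    (c : 'I_m -> option K) : trigraph :=
  red_ext (fun j j' : 'I_m => (j.+1 == j') && eqadj (h j) (h j'))
    (fun x j =>
      (c j == Some x) || [&& j == 0 :> nat, x == p & eqadj p (h j)]).

Section Rail.
Variables (K : trigraph) (S : {set K}) (k : nat).
Hypothesis S_black_free : {in S, forall y, black_deg y = 0}.
Hypothesis k_ge4 : 4 <= k.

Lemma max_red_deg_rail m p (h : 'I_m -> K) (c : 'I_m -> option K) :
  p \in S ->
  (forall x, red_deg x + (x \in S) + #|[set j | c j == Some x]| <= k) ->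
  max_red_deg (rail p h c) <= k.
Proof.
move=> pS deg_k; apply/max_red_deg_leP => [] [x|j].
  rewrite red_deg_red_extl; apply: leq_trans (deg_k x).
  rewrite -addnA leq_add2l addnC.
  apply: leq_trans (card_set_leD (fun j => id)) _; rewrite leq_add2l.
  have [xS|xNS] := boolP (x \in S); last first.
    have xp : x != p by apply: contraNneq xNS => ->.
    rewrite leqn0 cards_eq0; apply/eqP/setP => j.
    by rewrite !inE (negPf xp) andbF.
  apply: card_set_le1 => j j' /andP[/eqP j0 _] /andP[/eqP j'0 _].
  by apply: val_inj; rewrite /= j0.
rewrite red_deg_red_extr; apply: leq_trans k_ge4.
apply: (@leq_add _ _ 2 2); last first.
  rewrite (card_ord_adjacent (p := j)) // => j' /andP[_].
  by case/orP=> /andP[-> _]; rewrite ?orbT.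
apply: leq_trans (card_set_leD (fun x => id)) _.
apply: (@leq_add _ _ 1 1); apply: card_set_le1 => x y.
  by move=> /eqP -> /eqP[].
by move=> /and3P[_ /eqP -> _] /and3P[_ /eqP -> _].
Qed.

Lemma tww_rail_nil p (h : 'I_0 -> K) (c : 'I_0 -> option K) :
  tww (rail p h c) <= tww K.
Proof.
pose g (v : rail p h c) : K := match v with inl x => x | inr j => p end.
apply: (@tww_coarsening_inj _ _ g); last by case=> [x|[]//] [y|[]//] /= ->.
by apply: coarsening_red_ext => [|x []|[]|[]] //; exact: coarsening_id.
Qed.

Lemma tww_rail_cons m p (h : 'I_m.+1 -> K) (c : 'I_m.+1 -> option K) :
  h ord0 \in S -> (forall x, c ord0 = Some x -> eqadj x (h ord0)) ->
  tww (rail p h c) <= maxn (max_red_deg (rail p h c))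
    (tww (rail (h ord0) (h \o lift ord0) (c \o lift ord0))).
Proof.
move=> hS c_eqadj; set next := rail (h ord0) _ _.
pose g (v : rail p h c) : next :=
  match v with
  | inl x => inl x
  | inr j => if unlift ord0 j is Some j' then inr j' else inl (h ord0)
  end.
apply: (@tww_merge _ _ g (inl (h ord0)) (inr ord0)).
  apply: coarsening_red_ext => [|x j|j j' /andP[/eqP jj' hh']|j v].
  - exact: coarsening_inl.
  - rewrite eqadj_red_ext /=; case: unliftP => [j' ->|->] /=.
      by rewrite orbF => ->.
    by case/orP=> [/eqP/c_eqadj|/andP[/eqP ->]].
  - rewrite eqadj_red_ext /=.
    case: (unliftP ord0 j') jj' hh' => [i' ->|->] //; rewrite lift0 => -[].
    by case: (unliftP ord0 j) => [i ->|->] /= <- ->; rewrite ?eqxx ?orbT.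
  rewrite /=; case: unliftP => //= _; case: v => [x|j'] /=.
    by rewrite black_deg0 // S_black_free.
  by case: unliftP => //= _; rewrite black_irr.
have merged j y : inl y = g (inr j) -> y = h ord0 /\ j = ord0.
  by rewrite /=; case: unliftP => //= -> [->].
move=> [x|j] [y|j'].
- by case=> ->; left.
- by move/merged=> [-> ->]; right; rewrite !inE !eqxx.
- by move/esym/merged=> [-> ->]; right; rewrite !inE !eqxx.
rewrite /=; case: unliftP => [i ->|->]; case: unliftP => [i' ->|->] //.
  by case=> ->; left.
by left.
Qed.

Lemma tww_rail m p (h : 'I_m -> K) (c : 'I_m -> option K) :
  tww K <= k -> p \in S -> (forall j, h j \in S) ->
  (forall j x, c j = Some x -> eqadj x (h j)) ->
  (forall x, red_deg x + (x \in S) + #|[set j | c j == Some x]| <= k) ->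
  tww (rail p h c) <= k.
Proof.
move=> Kk; elim: m => [|m IHm] in p h c *; move=> pS hS c_eqadj deg_k.
  exact: leq_trans (tww_rail_nil _ _ _) Kk.
apply: leq_trans (tww_rail_cons _ (hS ord0) (c_eqadj ord0)) _.
rewrite geq_max max_red_deg_rail // IHm // => [j|j x|x].
- exact: hS.
- exact: c_eqadj.
apply: leq_trans (deg_k x); rewrite leq_add2l.
rewrite -(card_imset _ (@lift_inj _ ord0)); apply/subset_leq_card/subsetP => j.
by case/imsetP=> i; rewrite !inE => ci ->.
Qed.

End Rail.

(** * Ears *)

(* The walk from [p] towards [q] by unit steps, stopping at [q]. *)
Definition walk (p q j : nat) : nat := maxn (p - j) (minn (p + j) q).

Section Ears.
Variables (C : trigraph) (I : finType) (a b : I -> C) (D : nat).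

(* Ear [i] is formed by the vertices [(i, j)] with [j < n i]; the others only
   extend its path and make the vertex set independent of [n]. *)
Definition eared (n : I -> nat) : trigraph :=
  red_ext
    (fun p q : I * 'I_D => (p.1 == q.1) && (p.2.+1 == q.2))
    (fun x p => (p.2 == 0 :> nat) && (a p.1 == x)
      || (p.2.+1 == n p.1) && (b p.1 == x)).

Definition ear_ends (x : C) : nat :=
  #|[set i | a i == x]| + #|[set i | b i == x]|.

Section Zipping.
Variables (n : I -> nat) (N : nat) (r : C -> nat).
Hypothesis r_le : forall x, r x <= N.
Hypothesis n_gt : forall i, N < n i.
Hypothesis n_gt1 : forall i, 1 < n i.

Definition zip_target (q : I * 'I_D) : bus N r :=
  inr (inord (walk (r (a q.1)) (r (b q.1)) q.2)).

Definition ear_attachment (q : I * 'I_D) : option (bus N r) :=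
  if q.2 == 0 :> nat then Some (inl (a q.1))
  else if q.2.+1 == n q.1 then Some (inl (b q.1)) else None.

Lemma inord_walk i j :
  (inord (walk (r (a i)) (r (b i)) j) : 'I_N.+1) =
  walk (r (a i)) (r (b i)) j :> nat.
Proof. by rewrite inordK // /walk; move: (r_le (a i)) (r_le (b i)); lia. Qed.

Lemma eqadj_ear_attachment q v :
  ear_attachment q = Some v -> eqadj v (zip_target q).
Proof.
case: q => i j; rewrite /ear_attachment /=; case: eqP => [j0 [<-]|_].
  by rewrite eqadj_red_ext /= inord_walk j0 /walk; lia.
case: eqP => // jn [<-]; rewrite eqadj_red_ext /= inord_walk /walk.
by move: (n_gt i) (r_le (a i)) (r_le (b i)); lia.
Qed.

Lemma eqadj_zip_target i (j j' : 'I_D) :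
  j.+1 = j' -> eqadj (zip_target (i, j)) (zip_target (i, j')).
Proof.
move=> jj'; rewrite eqadj_red_ext /= -val_eqE /= !inord_walk -jj' /walk; lia.
Qed.

Lemma card_ear_attachment x :
  #|[set q | ear_attachment q == Some (inl x)]| <= ear_ends x.
Proof.
pose first_at (q : I * 'I_D) := (q.2 == 0 :> nat) && (a q.1 == x).
pose last_at (q : I * 'I_D) := (q.2.+1 == n q.1) && (b q.1 == x).
have first_or_last q :
    ear_attachment q == Some (inl x) -> first_at q || last_at q.
  rewrite /ear_attachment /first_at /last_at; case: (_ == 0) => [/eqP[->]|].
    by rewrite eqxx.
  by case: (_ == n _) => // /eqP[->]; rewrite eqxx orbT.
have card_fst (Q : pred (I * 'I_D)) (c : I -> C) :
    (forall q q', Q q -> Q q' -> q.1 = q'.1 -> q.2 = q'.2) ->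
    (forall q, Q q -> c q.1 == x) -> #|[set q | Q q]| <= #|[set i | c i == x]|.
  move=> Quniq Qc; rewrite -(card_in_imset (f := fst) (D := [set q | Q q])).
    apply/subset_leq_card/subsetP => i /imsetP[q].
    by rewrite !inE => /Qc cq ->.
  move=> [i j] [i' j']; rewrite !inE => Qij Qij' /= ii'.
  by congr (_, _) => //; exact: Quniq Qij Qij' ii'.
apply: leq_trans (card_set_leD first_or_last) _; apply: leq_add.
  apply: card_fst => [q q' /andP[/eqP q0 _] /andP[/eqP q'0 _] _|q /andP[]//].
  by apply: val_inj; rewrite /= q0.
apply: card_fst => [q q' /andP[/eqP qn _] /andP[/eqP q'n _] qq'|q /andP[]//].
by apply: val_inj; move: qn q'n; rewrite -qq' => <- [].
Qed.

Lemma ear_attachment_inr q p : (ear_attachment q == Some (inr p)) = false.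
Proof. by rewrite /ear_attachment; case: ifP => // _; case: ifP. Qed.

Definition eared_rail : trigraph :=
  rail (m := #|{: I * 'I_D}|) (inr ord0 : bus N r)
    (zip_target \o enum_val) (ear_attachment \o enum_val).

Lemma tww_eared_rail : tww (eared n) <= tww eared_rail.
Proof.
pose g (v : eared n) : eared_rail :=
  match v with inl x => inl (inl x) | inr q => inr (enum_rank q) end.
apply: (@tww_coarsening_inj _ _ g); last first.
  by move=> [x|q] [y|q'] //= [] => [->|/enum_rank_inj ->].
apply: coarsening_red_ext => [|x q|[i j] [i' j'] /andP[/eqP /= <- /eqP jj']|//].
- exact: (coarsening_comp (coarsening_inl _ _) (coarsening_inl _ _)).
- rewrite eqadj_red_ext /= enum_rankK /ear_attachment.
  case/orP=> /andP[/eqP qE /eqP ->]; first by rewrite qE !eqxx.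
  have [q0|_] := eqVneq (q.2 : nat) 0; last by rewrite qE !eqxx.
  by have := n_gt1 q.1; rewrite -qE q0.
rewrite eqadj_red_ext /= !enum_rankK eqadj_zip_target //.
by rewrite (enum_rank_succ _ jj') eqxx orbT.
Qed.

Lemma tww_eared_rail_le t :
  3 <= t -> injective r -> tww (bus N r) <= t.+1 ->
  (forall x, red_deg x + ear_ends x <= t) -> tww eared_rail <= t.+1.
Proof.
move=> t_ge3 rI busC deg_t.
pose S : {set bus N r} := [set v | if v is inr _ then true else false].
apply: (@tww_rail _ S t.+1) => //; rewrite ?inE //.
- case=> [x|p]; rewrite inE // => _.
  by apply/eqP; rewrite cards_eq0; apply/eqP/setP => v; rewrite !inE.
- by move=> j; rewrite inE.
- by move=> j v; exact: eqadj_ear_attachment.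
move=> v; rewrite (card_enum_val_set (fun q => ear_attachment q == Some v)).
case: v => [x|p]; rewrite inE.
  rewrite addn0.
  apply: leq_trans (leq_add (red_deg_busl _ _ _) (card_ear_attachment x)) _.
  by rewrite addSn ltnS deg_t.
rewrite (_ : [set q | _] = set0) ?cards0; last first.
  by apply/setP => q; rewrite !inE ear_attachment_inr.
by have := red_deg_busr r p; have := card_fiber_inj (p : nat) rI; lia.
Qed.

End Zipping.

Lemma tww_eared t n :
  3 <= t -> tww C <= t -> (forall x, red_deg x + ear_ends x <= t) ->
  (forall i, #|C| <= n i) -> (forall i, 1 < n i) -> tww (eared n) <= t.+1.
Proof.
move=> t_ge3 Ct deg_t nC n_gt1; have [C0|C_gt0] := posnP #|C|.
  have C_empty (x : C) : False by have := card0_eq C0 x.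
  rewrite tww_empty //; apply/eqP; rewrite -leqn0 leqNgt.
  by apply/card_gt0P => -[[x|[i _]] _]; [exact: C_empty x|exact: C_empty (a i)].
have [[s sE] _] := tww_spec C_gt0; rewrite -sE in Ct.
have [r [rI r_le busC]] := bus_order t_ge3 Ct (esym (prednK C_gt0)).
have n_gt i : #|C|.-1 < n i by rewrite prednK.
apply: leq_trans (tww_eared_rail r_le n_gt1) _.
exact: tww_eared_rail_le.
Qed.

(** * Shortening ears *)

Record ear_layout (G : trigraph) (part : I -> {set G}) (n : I -> nat)
    (pos : G -> eared n) : Prop := EarLayout {
  layout_inj : injective pos;
  layout_coarsening : coarsening pos;
  layout_lt : forall x i j, pos x = inr (i, j) -> j < n i;
  layout_part : forall i x, x \in part i -> exists j, pos x = inr (i, j) }.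

Lemma card_layout_part (G : trigraph) (part : I -> {set G}) n
    (pos : G -> eared n) i :
  ear_layout part pos -> #|part i| <= n i.
Proof.
move=> lay; pose rank x : nat := if pos x is inr q then q.2 else 0.
rewrite cardE -(size_map rank) -(size_iota 0 (n i)); apply: uniq_leq_size.
  rewrite map_inj_in_uniq ?enum_uniq // => x y; rewrite !mem_enum.
  move=> /(layout_part lay)[j posx] /(layout_part lay)[j' posy].
  rewrite /rank posx posy /= => /val_inj jj'; apply: (layout_inj lay).
  by rewrite posx posy jj'.
move=> _ /mapP[x + ->]; rewrite mem_enum mem_iota /rank.
by move=> /(layout_part lay)[j posx]; rewrite posx; exact: (layout_lt lay posx).
Qed.

Section Shift.
Variables (n : I -> nat) (i0 : I) (k : nat).

Definition shorten_length i := if i == i0 then (n i).-1 else n i.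

Lemma unbump_ord_subproof (j : 'I_D) : unbump k j < D.
Proof. by apply: leq_ltn_trans (ltn_ord j); rewrite /unbump leq_subr. Qed.

Definition shift_ear (q : I * 'I_D) : I * 'I_D :=
  (q.1, if q.1 == i0 then Ordinal (unbump_ord_subproof q.2) else q.2).

Definition shift : eared n -> eared shorten_length := map_sum id shift_ear.

Lemma shift_merges_only (p q : 'I_D) :
  (p == k :> nat) && (q == k.+1 :> nat) ||
  (p == k.+1 :> nat) && (q == k :> nat) ->
  merges_only shift (inr (i0, p)) (inr (i0, q)) /\
  shift (inr (i0, p)) = shift (inr (i0, q)).
Proof.
move=> pq; split; last first.
  rewrite /shift /= /shift_ear /= eqxx; congr (inr (_, _)).
  by apply: val_inj => /=; rewrite /unbump; lia.
apply: map_sum_merges_onlyr => // -[i j] [i' j']; rewrite /shift_ear /=.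
case=> <-; case: (eqVneq i i0) => [->|_ ->]; last by left.
move/(congr1 val) => /=; case/unbump_eq=> [/val_inj ->|[]]; first by left.
by rewrite !inE -!pair_eqE /= !eqxx /= -!val_eqE /=; right; lia.
Qed.

Hypothesis k_lt : k.+1 < n i0.

Lemma coarsening_shift : coarsening shift.
Proof.
apply: coarsening_map_red_ext => [|[i j] [i' j']|x [i j]].
- exact: coarsening_id.
- case/andP=> /eqP /= <- /eqP jj'; rewrite /shift_ear /=.
  case: (i == i0); last by rewrite !eqxx jj' eqxx orbT.
  rewrite -pair_eqE /= -val_eqE eqxx /= -jj'.
  by case: (unbump_succ k j) => ->; rewrite !eqxx ?orbT.
rewrite /shift_ear /shorten_length /=; case: (eqVneq i i0) => [->|//] /=.
case/orP=> /andP[/eqP jE ->]; rewrite !andbT; apply/orP; [left|right].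
  by rewrite jE.
by rewrite /unbump; lia.
Qed.

Lemma shift_lt (v : eared n) i j :
  (forall i j, v = inr (i, j) -> j < n i) ->
  shift v = inr (i, j) -> j < shorten_length i.
Proof.
case: v => // -[i' j'] /(_ _ _ erefl) j'n [<- <-]; rewrite /shorten_length /=.
by case: (eqVneq i' i0) j'n => // -> /=; rewrite /unbump; lia.
Qed.

End Shift.

Lemma ear_layout_contract (G : trigraph) (part : I -> {set G}) n
    (pos : G -> eared n) i (u v : G) :
  ear_layout part pos -> u \in part i -> v \in part i -> adj u v ->
  exists n' (pos' : contract u v -> eared n'),
    ear_layout (fun i' => contract_proj u v @: part i') pos'.
Proof.
move=> lay ui vi uv.
have [p posu] := layout_part lay ui; have [q posv] := layout_part lay vi.
have pq : (p.+1 == q) || (q.+1 == p).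
  have := coarsening_adj (layout_coarsening lay) uv.
  rewrite posu posv eqadj_red_ext /= eqxx /= => /orP[/eqP pqE|//].
  have /eqP[] := adj_neq uv; apply: (layout_inj lay).
  by rewrite posu posv pqE.
pose k := minn p q; have k_lt : k.+1 < n i.
  by move: (layout_lt lay posu) (layout_lt lay posv); lia.
have [|shift_uv shiftE] := @shift_merges_only n i k p q; first by lia.
rewrite -posu -posv in shift_uv shiftE; pose f := @shift n i k \o pos.
have f_coarse : coarsening f.
  exact: coarsening_comp (layout_coarsening lay) (coarsening_shift k_lt).
exists (shorten_length n i), (f \o @contract_repr _ u v); split.
- exact/inj_contract_repr/merges_only_comp_inj/shift_uv/(layout_inj lay).
- exact: coarsening_contract_repr.
- by move=> z i' j; apply: shift_lt => // i1 j1; exact: (layout_lt lay).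
move=> i' _ /imsetP[x xi ->]; have [j posx] := layout_part lay xi.
suff -> : (f \o @contract_repr _ u v) (contract_proj u v x) = f x.
  by rewrite /f /= posx; eexists.
rewrite /=; have [->|xv] := eqVneq x v; last by rewrite contract_projK.
by rewrite contract_proj_pair ?inE ?eqxx ?orbT.
Qed.

Lemma ear_layout_shortening (G G' : trigraph) (P : {set {set G}})
    (P' : {set {set G'}}) (part : I -> {set G}) n (pos : G -> eared n) :
  shortening P' P -> P = [set part i | i : I] -> ear_layout part pos ->
  exists (part' : I -> {set G'}) n' (pos' : G' -> eared n'),
    P' = [set part' i | i : I] /\ ear_layout part' pos'.
Proof.
move=> short; elim: short part n pos => {G P}
  [|G P X u v + + + uv _ IH] part n pos PE lay; first by exists part, n, pos.
rewrite PE => /imsetP[i _ ->] ui vi.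
have [n1 [pos1 lay1]] := ear_layout_contract lay ui vi uv.
by apply: IH lay1; rewrite PE -imset_comp.
Qed.

End Ears.

(** * Paths of vertices of degree 2 *)

Section DegreeTwoPaths.
Variable G : trigraph.
Implicit Types (a b u v x y z : G) (s p : seq G).

Lemma deg2_adj y v w z :
  deg y = 2 -> adj y v -> adj y w -> v != w -> adj y z -> z \in [:: v; w].
Proof.
move=> y_deg2 yv yw vw yz; have nbr_y : [set v; w] = [set z | adj y z].
  apply/eqP; rewrite eqEcard cards2 vw -/(deg y) y_deg2 andbT.
  by apply/subsetP => t; rewrite !inE => /orP[] /eqP ->.
have : z \in [set z | adj y z] by rewrite inE.
by rewrite -nbr_y !inE.
Qed.

Lemma deg2_path_adj a s b j z :
  path (@adj G) a (rcons s b) -> uniq s -> a \notin s -> b \notin s ->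
  1 < size s -> {in s, forall y, deg y = 2} -> j < size s ->
  adj (nth b s j) z -> z \in [:: nth b (a :: s) j; nth b s j.+1].
Proof.
move=> /(pathP b) s_path s_uniq aNs bNs s_gt1 s_deg2 js.
rewrite size_rcons in s_path.
have consecutive i : i < (size s).+1 -> adj (nth b (a :: s) i) (nth b s i).
  by move/s_path; rewrite -rcons_cons !nth_rcons_default.
apply: deg2_adj; rewrite ?s_deg2 ?mem_nth //.
- by rewrite adj_sym consecutive // ltnS ltnW.
- exact: (consecutive j.+1).
have [js1|sj1] := ltnP j.+1 (size s); last first.
  rewrite (nth_default _ sj1); case: j js sj1 => [|j] js sj1; first by lia.
  have prev_s : nth b s j \in s by rewrite mem_nth // ltnW.
  by apply: contraNneq bNs => /= prev_b; rewrite prev_b in prev_s.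
case: j => [|j] in js js1 *.
  by apply: contraNneq aNs => /= ->; rewrite mem_nth.
by rewrite /= nth_uniq ?(ltnW js) //; lia.
Qed.

Lemma mem_path_ends x p y : y \in [:: x; last x p] -> y \in x :: p.
Proof.
by rewrite !inE => /orP[] /eqP ->; rewrite ?eqxx // -in_cons mem_last.
Qed.

Lemma induced_path_path x p : induced_path (x :: p) -> path (@adj G) x p.
Proof.
move=> [s_uniq s_adj]; apply/(pathP x) => j jp.
have jp' : j < size (x :: p) := ltnW jp.
rewrite -[nth x p j]/(nth x (x :: p) j.+1) s_adj ?mem_nth //.
by rewrite !index_uniq ?eqxx.
Qed.

Lemma induced_path_exit x p y :
  induced_path (x :: p) -> y \in [:: x; last x p] -> 1 < deg y ->
  exists2 u, u \notin x :: p & adj y u.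
Proof.
move=> [s_uniq s_adj] y_end; set s := x :: p in s_uniq s_adj *.
have ys : y \in s := mem_path_ends y_end.
have y_index : index y s = 0 \/ index y s = size p.
  move: y_end; rewrite !inE => /orP[] /eqP ->; first by left; rewrite /= eqxx.
  by rewrite index_last; [right|].
have inner_le1 : #|[set z | adj y z] :&: [set z in s]| <= 1.
  apply/card_le1_eqP => z z'; rewrite !inE -!in_cons -/s.
  move=> /andP[yz zs] /andP[yz' z's]; have zz' : index z s = index z' s.
    move: yz yz'; rewrite !s_adj //; move: zs z's.
    by rewrite -!index_mem -[size s]/(size p).+1; lia.
  exact/esym/(index_inj x zs z's zz').
move=> y_deg; have /card_gt0P[u] : 0 < #|[set z | adj y z] :\: [set z in s]|.
  have := cardsID [set z in s] [set z | adj y z].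
  by rewrite /deg in y_deg; lia.
by rewrite !inE -in_cons => /andP[us yu]; exists u.
Qed.

Lemma induced_path_outer_adj x p :
  induced_path (x :: p) -> 0 < size p -> {in x :: p, forall y, deg y = 2} ->
  exists u v, [/\ u \notin x :: p, v \notin x :: p, adj x u, adj (last x p) v
    & forall y z, y \in x :: p -> z \notin x :: p -> adj y z ->
        y = x /\ z = u \/ y = last x p /\ z = v].
Proof.
move=> s_path p_gt0 s_deg2; have [s_uniq _] := s_path.
have exit y : y \in [:: x; last x p] -> exists2 u, u \notin x :: p & adj y u.
  move=> y_end; have y_deg2 := s_deg2 y (mem_path_ends y_end).
  by apply: (induced_path_exit s_path y_end); rewrite y_deg2.
have [u us xu] := exit x (mem_head _ _).
have [|v vs lv] := exit (last x p); first by rewrite !inE eqxx orbT.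
exists u, v; split=> // y z ys zs; rewrite -(nth_index v ys).
have ext_path : path (@adj G) u (rcons (x :: p) v).
  by rewrite rcons_path /= adj_sym xu induced_path_path.
move: ys; rewrite -index_mem => ys.
move/(deg2_path_adj ext_path s_uniq us vs p_gt0 s_deg2 ys).
rewrite !inE => /orP[] /eqP zE; [left|right].
  case: (index y _) ys zE => [//|j] js zE.
  by case/negP: zs; rewrite zE /= mem_nth // ltnW.
move: zs zE; have [js|] := ltnP (index y (x :: p)).+1 (size (x :: p)).
  by move=> + zE; rewrite zE mem_nth.
rewrite leq_eqVlt ltnNge ys orbF => /eqP sE _; rewrite -sE nth_default // => ->.
by rewrite -[last x p]/(last v (x :: p)) -nth_last sE.
Qed.

End DegreeTwoPaths.

(** * The ears of a tidy trigraph *)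

Section TidyEars.
Variables (G : trigraph) (H : {set G}) (P : {set {set G}}).
Implicit Types (y z : G) (X Y : {set G}).
Hypothesis tidyG : tidy_HP_graph H P.
Hypothesis P_gt1 : {in P, forall X, 1 < #|X|}.

Definition core : {set G} :=
  [set x in H | [forall z in cover P, ~~ adj x z]].

Definition ear X : {set G} :=
  X :|: [set u in H | [exists z in X, adj u z]].

Lemma mem_H_cover y : (y \in H) = (y \notin cover P).
Proof.
have [[_ _ [HP disjHP] _ _] _] := tidyG.
have := in_setT y; rewrite -HP inE; have [yP|yNP] := boolP (y \in cover P).
  by rewrite (disjointFl disjHP).
by rewrite orbF => ->.
Qed.

Lemma mem_part_cover X y : X \in P -> y \in X -> y \in cover P.
Proof. by move=> XP yX; apply/bigcupP; exists X. Qed.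

Lemma part_notin_H X y : X \in P -> y \in X -> y \notin H.
Proof. by move=> XP yX; rewrite mem_H_cover negbK (mem_part_cover XP). Qed.

Lemma part_eq X Y y : X \in P -> Y \in P -> y \in X -> y \in Y -> X = Y.
Proof.
have [[_ _ _ _ [trivP _]] _] := tidyG => XP YP yX yY.
by rewrite -(def_pblock trivP XP yX) (def_pblock trivP YP yY).
Qed.

Lemma adj_part X y z :
  X \in P -> y \in X -> z \in cover P -> adj y z -> z \in X.
Proof.
have [[_ _ _ _ [_ sepP]] _] := tidyG => XP yX /bigcupP[Y YP zY] yz.
have [-> //|XY] := eqVneq X Y.
by have := sepP _ _ XP YP XY _ _ yX zY; rewrite yz.
Qed.

Lemma core_sub_H y : y \in core -> y \in H.
Proof. by rewrite inE => /andP[]. Qed.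

Definition tidy_connector u z : Prop :=
  [/\ black_deg u = 0, [set y in cover P | adj u y] = [set z]
    & exists2 a, [set y in H | adj u y] = [set a] & 0 < black_deg a].

Lemma tidy_part X : X \in P ->
  exists x p u v,
    [/\ induced_path (x :: p) /\ 0 < size p, X =i x :: p,
        [/\ u \in H, v \in H, adj x u & adj (last x p) v],
        forall y z, y \in X -> z \in H -> adj y z ->
          y = x /\ z = u \/ y = last x p /\ z = v
      & forall y z, y \in X -> z \in H -> adj y z -> tidy_connector z y].
Proof.
move=> XP; have [_ /(_ X XP)[x [p [s_path XE _ X_deg2 ends]]]] := tidyG.
have Xs y : (y \in X) = (y \in x :: p) by rewrite XE inE.
have p_gt0 : 0 < size p.
  have [s_uniq _] := s_path.
  by have := P_gt1 XP; rewrite XE cardsE (card_uniqP s_uniq).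
have s_deg2 : {in x :: p, forall y, deg y = 2}.
  by move=> y; rewrite -Xs; exact: X_deg2.
have [u [v [us vs xu lv s_outer]]] :=
  induced_path_outer_adj s_path p_gt0 s_deg2.
have X_outer_H y z : y \in X -> z \notin X -> adj y z -> z \in H.
  move=> yX zX yz; rewrite mem_H_cover; apply: contra zX => zP.
  exact: adj_part yz.
have outer y z : y \in X -> z \in H -> adj y z ->
    y = x /\ z = u \/ y = last x p /\ z = v.
  rewrite Xs => ys zH; apply: s_outer => //.
  by rewrite -Xs; apply: contraL zH; exact: part_notin_H.
exists x, p, u, v; split=> // [|y z yX zH yz].
  split=> //; [apply: (X_outer_H x)|apply: (X_outer_H (last x p))];
    by rewrite ?Xs ?mem_last ?mem_head.
apply: (ends z y); last by rewrite adj_sym.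
  by split=> //; exists y; [exact: mem_part_cover yX|rewrite adj_sym].
by have [[-> _]|[-> _]] := outer y z yX zH yz; rewrite !inE eqxx ?orbT.
Qed.

Lemma tidy_connectorP X y z :
  X \in P -> y \in X -> z \in H -> adj z y -> tidy_connector z y.
Proof.
move=> XP yX zH; rewrite adj_sym => yz.
by have [x [p [u [v [_ _ _ _]]]]] := tidy_part XP; apply.
Qed.

Lemma connector_nbrs X y z : X \in P -> y \in X -> z \in H -> adj z y ->
  exists2 a, a \in core & adj z =1 [in [:: a; y]].
Proof.
move=> XP yX zH zy.
have [_ nbrP [a nbrH a_black]] := tidy_connectorP XP yX zH zy.
have aH : a \in H by have := set11 a; rewrite -nbrH inE => /andP[].
exists a => [|t].
  rewrite inE aH; apply/forallP => t; apply/implyP => /bigcupP[Y YP tY].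
  apply/negP => /(tidy_connectorP YP tY aH)[a0 _ _].
  by rewrite a0 in a_black.
rewrite /= !inE; have [tP|] := boolP (t \in cover P).
  have /negPf -> : t != a by apply: contraTneq tP => ->; rewrite -mem_H_cover.
  by rewrite -in_set1 -nbrP inE tP.
rewrite -mem_H_cover => tH.
have /negPf -> : t != y.
  by apply: contraTneq tH => ->; exact: part_notin_H yX.
by rewrite orbF -in_set1 -nbrH inE tH.
Qed.

Lemma mem_ear X y :
  y \in ear X -> y \in X \/ y \in H /\ exists2 z, z \in X & adj y z.
Proof.
by rewrite !inE => /orP[|/andP[yH /exists_inP yX]]; [left|right].
Qed.

Lemma ear_notin_core X y : X \in P -> y \in ear X -> y \notin core.
Proof.
move=> XP /mem_ear[yX|[yH [z zX yz]]].
  by apply: contra (part_notin_H XP yX); exact: core_sub_H.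
rewrite inE yH negb_forall; apply/existsP; exists z.
by rewrite (mem_part_cover XP zX) yz.
Qed.

Lemma ear_cover y : y \notin core -> exists2 X, X \in P & y \in ear X.
Proof.
rewrite inE mem_H_cover.
have [/bigcupP[X XP yX] _|yNP] := boolP (y \in cover P).
  by exists X => //; rewrite inE yX.
rewrite negb_forall => /existsP[z]; rewrite negb_imply negbK => /andP[].
case/bigcupP=> X XP zX yz; exists X => //; rewrite !inE mem_H_cover yNP.
by apply/orP; right; apply/exists_inP; exists z.
Qed.

Lemma ear_eq X Y y :
  X \in P -> Y \in P -> y \in ear X -> y \in ear Y -> X = Y.
Proof.
move=> XP YP; case/mem_ear=> [yX|[yH [z zX yz]]];
  case/mem_ear=> [yY|[yH' [z' z'Y yz']]].
- exact: part_eq yX yY.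
- by have := part_notin_H XP yX; rewrite yH'.
- by have := part_notin_H YP yY; rewrite yH.
have [_ nbrP _] := tidy_connectorP XP zX yH yz.
have : z' \in [set z] by rewrite -nbrP inE yz' (mem_part_cover YP).
by move/set1P=> zE; rewrite zE in z'Y; exact: part_eq zX z'Y.
Qed.

Lemma black_deg_ear X y : X \in P -> y \in ear X -> black_deg y = 0.
Proof.
move=> XP /mem_ear[yX|[yH [z zX yz]]]; last first.
  by have [] := tidy_connectorP XP zX yH yz.
apply/eqP; rewrite cards_eq0; apply/eqP/setP => z; rewrite !inE.
apply/negP => yz; have yz_adj : adj y z by rewrite /adj yz.
have [zP|] := boolP (z \in cover P).
  have [_ /(_ X XP)[x [p [_ _ X_red _ _]]]] := tidyG.
  have yz_red := X_red _ _ yX (adj_part XP yX zP yz_adj) yz_adj.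
  by have := black_red y z; rewrite yz yz_red.
rewrite -mem_H_cover => zH; have zy : adj z y by rewrite adj_sym.
have [z0 _ _] := tidy_connectorP XP yX zH zy.
by rewrite black_sym black_deg0 in yz.
Qed.

Lemma deg_ear X y : X \in P -> y \in ear X -> deg y = 2.
Proof.
move=> XP /mem_ear[yX|[yH [z zX yz]]].
  by have [_ /(_ X XP)[x [p [_ _ _ X_deg2 _]]]] := tidyG; exact: X_deg2.
have [a /core_sub_H aH nbr] := connector_nbrs XP zX yH yz.
have -> : deg y = #|[set a; z]|.
  by apply: eq_card => t; rewrite !inE nbr !inE.
rewrite cards2; suff -> : a != z by [].
by apply: contraTneq aH => ->; exact: part_notin_H zX.
Qed.

(* [s] enumerates the ear of [X] from the neighbour of [a] to that of [b]. *)
Definition ear_sequence X (a b : G) (s : seq G) : Prop :=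
  [/\ a \in core /\ b \in core, s =i ear X, uniq s, 1 < size s
    & path (@adj G) a (rcons s b)].

Lemma ear_sequence_exists X : X \in P -> exists a b s, ear_sequence X a b s.
Proof.
move=> XP.
have [x [p [u [v [[s_path p_gt0] Xs [uH vH xu lv] outer _]]]]] := tidy_part XP.
have [xX lX] : x \in X /\ last x p \in X by rewrite !Xs mem_head mem_last.
have ux : adj u x by rewrite adj_sym.
have vl : adj v (last x p) by rewrite adj_sym.
have [a a_core nbr_u] := connector_nbrs XP xX uH ux.
have [b b_core nbr_v] := connector_nbrs XP lX vH vl.
have H_notin y : y \in H -> y \notin x :: p.
  by rewrite -Xs; apply: contraL; exact: part_notin_H.
have [s_uniq _] := s_path.
have uv : u != v.
  apply/eqP => uvE; have := nbr_u (last x p); rewrite uvE vl => /esym.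
  have /negPf la : last x p != a.
    by apply: contraTneq lX => ->; rewrite Xs H_notin ?core_sub_H.
  rewrite /= !inE la /= => /eqP lx; have := index_last s_uniq.
  by rewrite lx /= eqxx => p0; rewrite -p0 in p_gt0.
exists a, b, (u :: rcons (x :: p) v); split=> //.
- move=> y; rewrite in_cons mem_rcons in_cons -Xs !inE.
  have [yX|yX] /= := boolP (y \in X); first by rewrite !orbT.
  rewrite orbF; apply/orP/andP => [[/eqP ->|/eqP ->]|[yH /exists_inP[z zX yz]]].
  + by split=> //; apply/exists_inP; exists x.
  + by split=> //; apply/exists_inP; exists (last x p).
  + rewrite adj_sym in yz.
    by have [[_ ->]|[_ ->]] := outer z y zX yH yz; [left|right].
- by rewrite cons_uniq rcons_uniq mem_rcons in_cons negb_or uv !H_notin.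
rewrite rcons_cons /= !rcons_path last_rcons /= lv ux induced_path_path //=.
by rewrite adj_sym nbr_u nbr_v /= !inE !eqxx.
Qed.

Local Notation parts := {X : {set G} | X \in P}.

Lemma ear_sequences_exist :
  exists (a b : parts -> induced core) (s : parts -> seq G),
    forall i, ear_sequence (val i) (val (a i)) (val (b i)) (s i).
Proof.
have /boolp.choice[f fP] (i : parts) :
    exists abs : induced core * induced core * seq G,
      ear_sequence (val i) (val abs.1.1) (val abs.1.2) abs.2.
  have [a [b [s seqX]]] := ear_sequence_exists (valP i).
  by have [[aC bC] _ _ _ _] := seqX; exists (Sub a aC, Sub b bC, s).
by exists (fun i => (f i).1.1), (fun i => (f i).1.2), (fun i => (f i).2).
Qed.

Section EarVertices.
Variables (a b : parts -> induced core) (s : parts -> seq G).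
Hypothesis s_ear :
  forall i, ear_sequence (val i) (val (a i)) (val (b i)) (s i).

Definition ear_vertex i j : G := nth (val (b i)) (s i) j.

Lemma mem_ear_vertex i j : j < size (s i) -> ear_vertex i j \in ear (val i).
Proof. by have [_ <- _ _ _] := s_ear i; exact: mem_nth. Qed.

Lemma ear_vertex_notin_core i j : j < size (s i) -> ear_vertex i j \notin core.
Proof. by move/mem_ear_vertex; exact: ear_notin_core (valP i). Qed.

Lemma ear_vertex_inj i j i' j' : j < size (s i) -> j' < size (s i') ->
  ear_vertex i j = ear_vertex i' j' -> i = i' /\ j = j'.
Proof.
move=> js js' vE; have ii' : i = i'.
  apply/val_inj/(ear_eq (valP i) (valP i') (mem_ear_vertex js)).
  by rewrite vE mem_ear_vertex.
split=> //; move: js' vE; rewrite -ii' => js'.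
have [_ _ s_uniq _ _] := s_ear i.
by move/eqP; rewrite nth_uniq // => /eqP.
Qed.

Lemma mem_ear_exists_vertex i y :
  y \in ear (val i) -> exists2 j, j < size (s i) & y = ear_vertex i j.
Proof.
have [_ <- _ _ _] := s_ear i => ys.
by exists (index y (s i)); rewrite ?index_mem // /ear_vertex nth_index.
Qed.

Lemma ear_vertex_adj i j z : j < size (s i) -> adj (ear_vertex i j) z ->
  [\/ j = 0 /\ z = val (a i), j.+1 = size (s i) /\ z = val (b i)
    | exists j', [/\ j' < size (s i), z = ear_vertex i j'
        & (j.+1 == j') || (j'.+1 == j)]].
Proof.
have [[aC bC] sE s_uniq s_gt1 s_path] := s_ear i.
have core_notin c : c \in core -> c \notin s i.
  by apply: contraL; rewrite sE; exact: ear_notin_core (valP i).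
have s_deg2 : {in s i, forall y, deg y = 2}.
  by move=> y; rewrite sE; exact: deg_ear (valP i).
have [aNs bNs] := (core_notin _ aC, core_notin _ bC).
move=> js /(deg2_path_adj s_path s_uniq aNs bNs s_gt1 s_deg2 js).
rewrite !inE => /orP[] /eqP ->.
  case: j js => [|j] js; first by constructor 1.
  by constructor 3; exists j; rewrite (ltnW js) eqxx orbT.
have [js1|sj1] := ltnP j.+1 (size (s i)).
  by constructor 3; exists j.+1; rewrite js1 eqxx.
by constructor 2; rewrite nth_default //; split=> //; lia.
Qed.

Lemma red_ear_first i : red (val (a i)) (ear_vertex i 0).
Proof.
have [_ _ _ s_gt1 s_path] := s_ear i; have s_gt0 := ltnW s_gt1.
rewrite red_sym -adj_black_deg0 ?(black_deg_ear (valP i)) ?mem_ear_vertex //.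
rewrite adj_sym /ear_vertex; case: (s i) s_gt0 s_path => // x t _ /=.
by case/andP.
Qed.

Lemma red_ear_last i : red (val (b i)) (ear_vertex i (size (s i)).-1).
Proof.
have [_ _ _ s_gt1 s_path] := s_ear i; have s_gt0 := ltnW s_gt1.
have last_lt : (size (s i)).-1 < size (s i) by rewrite prednK.
rewrite red_sym -adj_black_deg0 ?(black_deg_ear (valP i)) ?mem_ear_vertex //.
rewrite /ear_vertex nth_last; case: (s i) s_gt0 s_path => // x t _ /=.
by rewrite rcons_path => /and3P[].
Qed.

Definition end_vertex (v : induced core + (parts + parts)) : G :=
  match v with
  | inl c => val c
  | inr (inl i) => ear_vertex i 0
  | inr (inr i) => ear_vertex i (size (s i)).-1
  end.

Lemma end_vertex_inj : injective end_vertex.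
Proof.
have size_gt1 i : 1 < size (s i) by have [] := s_ear i.
have last_lt i : (size (s i)).-1 < size (s i) by rewrite prednK // ltnW.
have core_end (c : induced core) (v : parts + parts) :
    val c <> end_vertex (inr v).
  move=> cE; have /negP[] : end_vertex (inr v) \notin core.
    by case: v {cE} => i /=; rewrite ear_vertex_notin_core // ltnW.
  by rewrite -cE mem_induced.
have first_last i i' : ear_vertex i 0 <> ear_vertex i' (size (s i')).-1.
  case/ear_vertex_inj=> // [|<-]; first exact: ltnW.
  by move: (size_gt1 i); case: size => [|[]].
move=> [c|[i|i]] [c'|[i'|i']] //=.
- by move/val_inj=> ->.
- by case/(core_end c (inl i')).
- by case/(core_end c (inr i')).
- by case/esym/(core_end c' (inl i)).
- by case/ear_vertex_inj=> [||-> //]; exact: ltnW.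
- by case/first_last.
- by case/esym/(core_end c' (inr i)).
- by case/esym/first_last.
- by case/ear_vertex_inj=> // ->.
Qed.

Lemma red_deg_core (x : induced core) :
  red_deg x + ear_ends a b x <= red_deg (val x).
Proof.
pose at_x (v : induced core + (parts + parts)) :=
  match v with
  | inl c => red x c
  | inr (inl i) => a i == x
  | inr (inr i) => b i == x
  end.
have -> : red_deg x + ear_ends a b x = #|[set v | at_x v]|.
  by rewrite !card_sum_set.
rewrite -(card_imset _ end_vertex_inj); apply/subset_leq_card/subsetP => y.
case/imsetP=> v; rewrite !inE => + ->; case: v => [c|[i|i]] //= /eqP <-.
  exact: red_ear_first.
exact: red_ear_last.
Qed.

Local Notation eared_core := (eared a b #|G| (fun i => size (s i))).

Definition located (y : G) (v : eared_core) : Prop :=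
  match v with
  | inl c => y = val c
  | inr (i, j) => j < size (s i) /\ y = ear_vertex i j
  end.

Lemma located_inj y z v : located y v -> located z v -> y = z.
Proof. by case: v => [c|[i j]] /=; [move=> -> ->|move=> [_ ->] [_ ->]]. Qed.

Lemma located_exists y : exists v, located y v.
Proof.
have [yC|/ear_cover[X XP]] := boolP (y \in core).
  by exists (inl (Sub y yC)).
case/(@mem_ear_exists_vertex (Sub X XP))=> j js yE; have jG : j < #|G|.
  have [_ _ s_uniq _ _] := s_ear (Sub X XP).
  by apply: leq_trans js _; rewrite -(card_uniqP s_uniq) max_card.
by exists (inr (Sub X XP, Ordinal jG)).
Qed.

Lemma eqadj_located y z v w :
  located y v -> located z w -> adj y z -> eqadj v w.
Proof.
have core_ear (c : induced core) i (j : 'I_#|G|) : j < size (s i) ->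
    adj (ear_vertex i j) (val c) -> @eqadj eared_core (inl c) (inr (i, j)).
  move=> js /(ear_vertex_adj js); rewrite eqadj_red_ext.
  case=> [[jE /val_inj ->]|[jE /val_inj ->]|[j' [js' cE _]]].
  - by rewrite /= jE !eqxx.
  - by rewrite /= jE !eqxx orbT.
  - by have := ear_vertex_notin_core js'; rewrite -cE mem_induced.
case: v w => [c|[i j]] [c'|[i' j']] /=.
- by move=> -> -> cc'; rewrite eqadj_red_ext; apply: adjW.
- by move=> -> [js' ->]; rewrite adj_sym; exact: core_ear.
- by move=> [js ->] ->; rewrite eqadj_sym; exact: core_ear.
move=> [js ->] [js' ->] /(ear_vertex_adj js).
have notin_core (c : induced core) : ear_vertex i' j' <> val c.
  by move=> vE; have := ear_vertex_notin_core js'; rewrite vE mem_induced.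
case=> [[_ /notin_core]|[_ /notin_core]|[k [ks vE jk]]] //.
have [<- j'E] := ear_vertex_inj js' ks vE.
by rewrite eqadj_red_ext /= j'E eqxx /= jk orbT.
Qed.

Lemma located_layout (pos : G -> eared_core) :
  (forall y, located y (pos y)) -> ear_layout (fun i => val i : {set G}) pos.
Proof.
move=> posP; split.
- by move=> y z yz; apply: located_inj (posP y) _; rewrite yz.
- split=> y z; first exact: eqadj_located.
  have := posP z; have := posP y; case: (pos y) => [c|[i j]] //.
  by case: (pos z) => [c'|[i j]] //= -> ->.
- by move=> y i j yE; have := posP y; rewrite yE => -[].
move=> i y yi; have y_ear : y \in ear (val i) by rewrite inE yi.
have := posP y; case: (pos y) => [c yE|[i' j] [js yE]].
  by have := ear_notin_core (valP i) y_ear; rewrite yE mem_induced.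
exists j; rewrite yE in y_ear.
by rewrite (val_inj (ear_eq (valP i) (valP i') y_ear (mem_ear_vertex js))).
Qed.

End EarVertices.

Lemma tidy_ear_layout :
  exists (a b : parts -> induced core) n (pos : G -> eared a b #|G| n),
    ear_layout (fun i => val i : {set G}) pos /\
    forall x, red_deg x + ear_ends a b x <= red_deg (val x).
Proof.
have [a [b [s s_ear]]] := ear_sequences_exist.
have /boolp.choice[pos posP] := located_exists s_ear.
exists a, b, (fun i => size (s i)), pos; split; first exact: located_layout.
exact: red_deg_core.
Qed.

End TidyEars.

Lemma ltn_card_min_length (G : trigraph) (H : {set G}) : #|H| < min_length H.
Proof.
rewrite /min_length /fH; have [->//|] := posnP #|H|; set h := #|H| => h_gt0.
suff : h <= (3 ^ (h + 4) * h ^ 2) ^ (2 * h ^ 2) by lia.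
have h_exp : h <= 3 ^ (h + 4).
  apply: leq_trans (ltnW (ltn_expl h (isT : 1 < 3))) _.
  by rewrite leq_pexp2l // leq_addr.
have h2_gt0 : 0 < h ^ 2 by rewrite expn_gt0 h_gt0.
apply: leq_trans h_exp (leq_trans (leq_pmulr _ h2_gt0) _).
rewrite -{1}[_ * _]expn1 leq_pexp2l //; first by rewrite muln_gt0 expn_gt0.
by rewrite muln_gt0.
Qed.

Theorem theorem43 (G : trigraph) (H : {set G}) (P : {set {set G}})
    (G' : trigraph) (P' : {set {set G'}}) :
  tidy_HP_graph H P ->
  3 <= tww G ->
  (forall X : {set G}, X \in P -> min_length H <= path_length X) ->
  shortening P' P ->
  (forall X : {set G'}, X \in P' -> min_length H <= path_length X) ->
  tww G' <= tww G + 1.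
Proof.
move=> tidyG tww_ge3 longP short longP'.
have min_gt1 : 1 < min_length H by rewrite /min_length; lia.
have P_gt1 : {in P, forall X : {set G}, 1 < #|X|}.
  by move=> X /longP; rewrite /path_length; lia.
have [a [b [n [pos [lay deg_core]]]]] := tidy_ear_layout tidyG P_gt1.
have PE : P = [set val i | i : {X : {set G} | X \in P}].
  apply/setP => X; apply/idP/imsetP => [XP|[i _ ->]]; last exact: valP.
  by exists (Sub X XP).
have [part [n' [pos' [P'E lay']]]] := ear_layout_shortening short PE lay.
have n'_gt i : min_length H < n' i.
  have /longP' : part i \in P' by rewrite P'E imset_f.
  by have := card_layout_part i lay'; rewrite /path_length; lia.
have core_H : #|induced (core H P)| <= #|H|.
  by rewrite card_sig subset_leq_card //; apply/subsetP => x; exact: core_sub_H.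
have [pos'I pos'_coarse _ _] := lay'; rewrite addn1.
apply: leq_trans (tww_coarsening_inj pos'_coarse pos'I) _.
apply: tww_eared => // [|x|i|i]; first exact: tww_induced.
- apply: leq_trans (deg_core x) _.
  exact: leq_trans (red_deg_max _) (max_red_deg_tww G).
- by move: (ltn_card_min_length H) (n'_gt i); lia.
- by move: (n'_gt i); lia.
Qed.
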